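(* Let $\theta>0$ and let $\overline{\mathbf{f}}=(\overline f_-,\overline f_+)$ be the random process associated with $\theta$ described in the context. There exists an event of probability one on which the following holds. Let $f_{\mathsf{V}}$ be any continuous function satisfying $\lim_{|x|\to\infty}\frac{f_{\mathsf{V}}(x)}{|x|}=\theta$. For each $T$, let $h_{\mathsf{V}}^T$ be the solution to the KPZ equation with initial condition $h_{\mathsf{V}}^T(-T,x)=f_{\mathsf{V}}(x)$ at time $-T$. For any sequence $T_k\uparrow\infty$, there exist a (possibly random) subsequence $T_{k_\ell}\uparrow\infty$ and a $\xi\in[0,1]$ such that $$\lim_{\ell\to\infty}\big[h_{\mathsf{V}}^{T_{k_\ell}}(0,\cdot)-h_{\mathsf{V}}^{T_{k_\ell}}(0,0)\big]=\log\big(\xi e^{\overline f_-}+(1-\xi)e^{\overline f_+}\big)$$ in the topology of $\mathcal{C}_{\mathrm{KPZ};0}$.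
   Context: Let $\mathrm{d}W$ be a space-time white noise on $\mathbf{R}\times\mathbf{R}$ (time $t$, space $x$). For $s<t$ and $x,y\in\mathbf{R}$ let $Z(t,x\,|\,s,y)$ be the fundamental solution of the multiplicative stochastic heat equation: $\mathrm{d}_tZ(t,x|s,y)=\frac12\Delta_xZ(t,x|s,y)\,\mathrm{d}t+Z(t,x|s,y)\,\mathrm{d}W(t,x)$ for $t>s$, with $Z(s,x|s,y)=\delta(x-y)$, in the version continuous in $(t,x,s,y)$, $s<t$, constructed simultaneously for all $t,x,s,y$ on one event of probability $1$. Define $\mathcal{C}_{\mathrm{KPZ}}=\{f\in\mathcal{C}(\mathbf{R}):\int_{\mathbf{R}}e^{f(x)-ax^2}\,\mathrm{d}x<\infty\text{ for all }a>0\}$, with the topology in which $f_n\to f$ iff $e^{f_n}\to e^f$ uniformly on compact sets and $\int e^{f_n(x)-ax^2}\mathrm{d}x\to\int e^{f(x)-ax^2}\mathrm{d}x$ for all $a>0$ (a Polish space), and $\mathcal{C}_{\mathrm{KPZ};0}=\{f\in\mathcal{C}_{\mathrm{KPZ}}:f(0)=0\}$ with the subspace topology. The (Cole–Hopf) solution of the KPZ equation, formally $\mathrm{d}h=\frac12[\Delta h+(\partial_xh)^2]\mathrm{d}t+\mathrm{d}W$, with initial data $h(s,\cdot)\in\mathcal{C}_{\mathrm{KPZ}}$ at time $s$ is $h(t,x)=\log\int_{\mathbf{R}}Z(t,x|s,y)e^{h(s,y)}\,\mathrm{d}y$ for $t>s$; almost surely $h(t,\cdot)\in\mathcal{C}_{\mathrm{KPZ}}$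 for all $t>s$. Solutions are all driven by the same noise. For $\theta>0$ let $\mathcal{Y}(\theta)=\{(f_-,f_+)\in\mathcal{C}_{\mathrm{KPZ}}^2:\lim_{|x|\to\infty}f_\pm(x)/x=\pm\theta\}$. The process $\overline{\mathbf f}$: it is known from prior work that, for each $\theta>0$, there is a random process $\overline{\mathbf{f}}=(\overline f_-,\overline f_+)\in\mathcal{C}_{\mathrm{KPZ};0}^2$ on the same probability space as the noise such that, with probability one, for every $\mathbf{f}\in\mathcal{Y}(\theta)$, if $\mathbf{h}^T=(h_-^T,h_+^T)$ is the vector of solutions to the KPZ equation with $\mathbf{h}^T(-T,\cdot)=\mathbf{f}$, then $\lim_{T\to\infty}[\mathbf{h}^T(0,\cdot)-\mathbf{h}^T(0,0)]=\overline{\mathbf{f}}$ in the topology of $\mathcal{C}_{\mathrm{KPZ};0}$ (componentwise). This property determines $\overline{\mathbf f}$ almost surely. *)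

(* Defs.v *)
From HB Require Import structures.
From mathcomp Require Import all_boot all_order all_algebra.
From mathcomp Require Import all_classical all_reals all_analysis.

Set Implicit Arguments.
Unset Strict Implicit.
Unset Printing Implicit Defensive.

Import Order.TTheory GRing.Theory Num.Theory.
Import numFieldNormedType.Exports.

Local Open Scope classical_set_scope.
Local Open Scope ring_scope.

(** * The spaces C_KPZ and C_KPZ;0 *)

Definition gauss_mass (R : realType) (f : R -> R) (a : R) : \bar R :=
  (\int[lebesgue_measure]_x (expR (f x - a * x ^+ 2))%:E)%E.

Definition CKPZ_set (R : realType) : set (R -> R) :=
  [set f | continuous f /\ forall a : R, 0 < a -> (gauss_mass f a < +oo)%E].
Arguments CKPZ_set R : clear implicits.

Definition CKPZ_embed (R : realType) (f : CKPZ_set R) :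
    ({compact-open, R -> R} * {ptws {posnum R} -> R})%type :=
  (fun x => expR (set_val f x), fun a => fine (gauss_mass (set_val f) a%:num)).

(* The coarsest topology making f |-> e^f (uniform convergence on compact sets)
   and f |-> \int e^(f(x) - a x^2) dx, for every a > 0, continuous; see
   cvg_CKPZ below. *)
Definition CKPZ (R : realType) : Type := initial_topology (@CKPZ_embed R).
HB.instance Definition _ (R : realType) := Topological.on (CKPZ R).

Definition CKPZ_fun (R : realType) (f : CKPZ R) : R -> R :=
  @set_val _ (CKPZ_set R) f.
Coercion CKPZ_fun : CKPZ >-> Funclass.

(* A set_type carries the subspace topology. *)
Definition CKPZ0_set (R : realType) : set (CKPZ R) := [set f | f 0 = 0].
Arguments CKPZ0_set R : clear implicits.
Definition CKPZ0 (R : realType) : Type := CKPZ0_set R.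
HB.instance Definition _ (R : realType) := Topological.on (CKPZ0 R).

Definition CKPZ0_val (R : realType) (f : CKPZ0 R) : CKPZ R :=
  @set_val _ (CKPZ0_set R) f.
Coercion CKPZ0_val : CKPZ0 >-> CKPZ.

Lemma cvg_initial (T : Type) (S : choiceType) (U : topologicalType)
    (phi : S -> U) (F : set_system T) (FF : Filter F)
    (u : T -> initial_topology phi) (f : initial_topology phi) :
  u @ F --> f <-> (fun t => phi (u t)) @ F --> phi f.
Proof.
split=> [uf|uf].
  exact: (cvg_comp u phi uf (@initial_continuous S U phi f)).
move=> A [_ [[B Bop <-] /= Bf BA]].
have fB : nbhs (phi f) B by apply: open_nbhs_nbhs; split.
by apply: (@filterS _ F FF _ _ _ (uf _ fB)) => t ?; exact: BA.
Qed.

Lemma cvg_CKPZ (R : realType) (T : Type) (F : set_system T) (FF : Filter F)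
    (u : T -> CKPZ R) (f : CKPZ R) :
  u @ F --> f <->
  {family compact, (fun t x => expR (u t x)) @ F --> (fun x => expR (f x))} /\
  (forall a : R, 0 < a ->
    fine (gauss_mass (u t) a) @[t --> F] --> fine (gauss_mass f a)).
Proof.
have ctsf : continuous (fun x => expR (f x)).
  have [cf _] := @set_valP _ (CKPZ_set R) f.
  move=> x; apply: continuous_comp; [exact: cf|exact: continuous_expR].
rewrite -(compact_open_fam_compactP ctsf).
apply: (iff_trans (cvg_initial _ _ _)); split.
  move=> cvg; split.
    by apply: (cvg_comp _ fst cvg); exact: cvg_fst.
  have c2 : (CKPZ_embed (u t)).2 @[t --> F] -->
      ((CKPZ_embed f).2 : {ptws {posnum R} -> R}).
    by apply: (cvg_comp _ snd cvg); exact: cvg_snd.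
  move=> a a0.
  exact: (cvg_comp _ _ c2 (@proj_continuous _ (fun=> R) (PosNum a0) _)).
move=> [c1 c2].
have k1 : (CKPZ_embed (u t)).1 @[t --> F] -->
    ((CKPZ_embed f).1 : {compact-open, R -> R}) by exact: c1.
have k2 : (CKPZ_embed (u t)).2 @[t --> F] -->
    ((CKPZ_embed f).2 : {ptws {posnum R} -> R}).
  apply/cvg_sup => a.
  apply/(@cvg_initial T ({ptws {posnum R} -> R}) R (fun g => g a)).
  exact: (c2 a%:num).
exact: (cvg_pair k1 k2).
Qed.

Lemma cvg_CKPZ0 (R : realType) (T : Type) (F : set_system T) (FF : Filter F)
    (u : T -> CKPZ0 R) (f : CKPZ0 R) :
  u @ F --> f <-> (fun t => u t : CKPZ R) @ F --> (f : CKPZ R).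
Proof. exact: cvg_initial. Qed.

(** * Space-time white noise and the Walsh integral *)

Section WhiteNoise.
Context (R : realType) (d : measure_display) (Omega : measurableType d).
Variable P : probability Omega R.

(* Points of R * R are (time, space). *)
Definition leb2 : set (R * R) -> \bar R :=
  (lebesgue_measure \x lebesgue_measure)%E.

Definition finite_borel (A : set (R * R)) : Prop :=
  measurable A /\ (leb2 A < +oo)%E.

(* normal_prob takes the standard deviation as its second argument, and
   normal_prob m 0 is not the Dirac mass at m. *)
Definition centered_gaussian (X : Omega -> R) (v : R) : Prop :=
  measurable_fun setT X /\
  forall B : set R, measurable B ->
    P (X @^-1` B) = if v == 0 then \d_(0 : R) B
                    else normal_prob 0 (Num.sqrt v) B.

(* W is a centered (jointly) Gaussian process indexed by the Borel sets of
   finite area, with covariance E[W(A) W(B)] = leb2 (A `&` B). *)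
Definition white_noise (W : set (R * R) -> Omega -> R) : Prop :=
  forall (n : nat) (c : 'I_n -> R) (A : 'I_n -> set (R * R)),
    (forall i, finite_borel (A i)) ->
    centered_gaussian (fun w => \sum_(i < n) c i * W (A i) w)
      (\sum_(i < n) \sum_(j < n) c i * c j * fine (leb2 (A i `&` A j))).

Variable W : set (R * R) -> Omega -> R.

(* Filtration of the noise, augmented with the P-null events. *)
Definition noise_filtration (t : R) : set (set Omega) :=
  <<s [set E : set Omega |
        (exists A : set (R * R), exists B : set R,
          [/\ finite_borel A, A `<=` [set q | q.1 <= t], measurable B &
              E = W A @^-1` B])
        \/ (measurable E /\ P E = 0%E)] >>.

(* Elementary predictable integrands
   \sum_i X_i(w) 1_(a_i, b_i](r) 1_(B_i)(z), X_i bounded and F_(a_i)-measurable. *)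
Record elementary := Elementary {
  el_size : nat;
  el_lo : 'I_el_size -> R;
  el_hi : 'I_el_size -> R;
  el_space : 'I_el_size -> set R;
  el_coef : 'I_el_size -> Omega -> R;
  el_lt : forall i, el_lo i < el_hi i;
  el_space_borel : forall i, measurable (el_space i);
  el_space_finite : forall i, (lebesgue_measure (el_space i) < +oo)%E;
  el_coef_adapted : forall i (B : set R), measurable B ->
    noise_filtration (el_lo i) (el_coef i @^-1` B);
  el_coef_bounded : forall i, exists M : R, forall w, `|el_coef i w| <= M
}.

Definition el_rect (e : elementary) (i : 'I_(el_size e)) : set (R * R) :=
  `]el_lo i, el_hi i] `*` el_space i.

Definition el_fun (e : elementary) (w : Omega) (q : R * R) : R :=
  \sum_(i < el_size e) el_coef i w * \1_(el_rect i) q.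

Definition el_integral (e : elementary) (w : Omega) : R :=
  \sum_(i < el_size e) el_coef i w * W (el_rect i) w.

(* I = \int Phi(r, z) W(dr, dz): the L^2(P) limit of the integrals of elementary
   integrands converging to Phi in L^2(P \x dr dz). *)
Definition is_walsh_integral (Phi : Omega -> R * R -> R) (I : Omega -> R) :=
  [/\ measurable_fun setT (fun p : Omega * (R * R) => Phi p.1 p.2),
      measurable_fun setT I &
      exists e : nat -> elementary,
        (\int[P]_w \int[leb2]_q ((el_fun (e n) w q - Phi w q) ^+ 2)%:E)%E
          @[n --> \oo] --> 0%E /\
        (\int[P]_w ((el_integral (e n) w - I w) ^+ 2)%:E)%E
          @[n --> \oo] --> 0%E].

(** * The stochastic heat equation and the KPZ equation *)

Definition heat_kernel (t x : R) : R := normal_pdf 0 (Num.sqrt t) x.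

(* Z w (t, x) (s, y) is Z(t, x | s, y).  The equation with initial datum
   Z(s, x | s, y) = delta(x - y) is understood in the mild (Walsh) sense. *)
Definition SHE_fundamental_solution (Z : Omega -> R * R -> R * R -> R) : Prop :=
  (forall t x s y : R, s < t ->
    is_walsh_integral
      (fun w q => if (s < q.1) && (q.1 < t)
                  then heat_kernel (t - q.1) (x - q.2) * Z w q (s, y)
                  else 0)
      (fun w => Z w (t, x) (s, y) - heat_kernel (t - s) (x - y)))
  /\
  {ae P, forall w, forall p : (R * R) * (R * R), p.2.1 < p.1.1 ->
    {for p, continuous (fun p => Z w p.1 p.2)}}.

End WhiteNoise.

(* Cole-Hopf solution at (t, x) of the KPZ equation started from f at time s, for
   one realization Z of the fundamental solution; it is a real number iff the
   integral is positive and finite. *)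
Definition KPZ_solution (R : realType) (Z : R * R -> R * R -> R)
    (s : R) (f : R -> R) (t x : R) : \bar R :=
  lne (\int[lebesgue_measure]_y (Z (t, x) (s, y) * expR (f y))%:E)%E.

(* h(0, .) - h(0, 0), where h is started from f at time -T. *)
Definition KPZ_increment (R : realType) (Z : R * R -> R * R -> R)
    (f : R -> R) (T : R) (x : R) : \bar R :=
  (KPZ_solution Z (- T) f 0 x - KPZ_solution Z (- T) f 0 0)%E.

(* Convergence in C_KPZ;0 of extended-real-valued functions which, eventually
   along F, are (finite and) elements of C_KPZ;0. *)
Definition cvg_in_CKPZ0 (R : realType) (I : Type) (F : set_system I)
    (u : I -> R -> \bar R) (g : CKPZ0 R) : Prop :=
  exists v : I -> CKPZ0 R,
    (\forall i \near F, forall x, u i x = (v i x)%:E) /\ v @ F --> g.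

Definition cvg_abs_infty (R : realType) (f : R -> R) (l : R) : Prop :=
  f x @[x --> +oo] --> l /\ f x @[x --> -oo] --> l.

Definition Ytheta (R : realType) (theta : R) : set (CKPZ R * CKPZ R) :=
  [set f : CKPZ R * CKPZ R |
           cvg_abs_infty (fun x => f.1 x / x) (- theta) /\
           cvg_abs_infty (fun x => f.2 x / x) theta].

(* fbar = (f_-, f_+) is a Borel random element of C_KPZ;0 ^ 2, and the almost sure
   pullback limit of the KPZ dynamics started from any pair in Y(theta). *)
Definition KPZ_pullback_limit (R : realType) (d : measure_display)
    (Omega : measurableType d) (P : probability Omega R)
    (Z : Omega -> R * R -> R * R -> R) (theta : R)
    (fbar : Omega -> CKPZ0 R * CKPZ0 R) : Prop :=
  (forall U : set (CKPZ0 R * CKPZ0 R), open U -> measurable (fbar @^-1` U)) /\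
  {ae P, forall w, forall f : CKPZ R * CKPZ R, Ytheta theta f ->
    cvg_in_CKPZ0 (pinfty_nbhs R) (KPZ_increment (Z w) f.1) (fbar w).1 /\
    cvg_in_CKPZ0 (pinfty_nbhs R) (KPZ_increment (Z w) f.2) (fbar w).2}.

(* Main.v *)
Require Import Defs.
From HB Require Import structures.
From mathcomp Require Import all_boot all_order all_algebra.
From mathcomp Require Import all_classical all_reals all_analysis.
From mathcomp Require Import measurable_realfun.
From mathcomp Require Import ring lra.

Set Implicit Arguments.
Unset Strict Implicit.
Unset Printing Implicit Defensive.

Import Order.TTheory GRing.Theory Num.Theory.
Import numFieldNormedType.Exports.

Local Open Scope classical_set_scope.
Local Open Scope ring_scope.

(** The solution of the stochastic heat equation is linear in its initial datum,
    and the logarithm turns this linearity into the claim.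

    The idea is to write a V-shaped initial condition as a log-sum of two
    one-sided ones,
      e^(f_V) = e^(g_-) + e^(g_+),  (g_-, g_+) in Y(theta),
    with the smooth partition of unity
      1/(1 + e^(2 theta x)) + 1/(1 + e^(-2 theta x)) = 1:
    multiplying e^(f_V) by the first weight turns the slope theta at +oo into
    -theta and keeps the slope at -oo, and symmetrically for the second
    ([tilt], [expR_tiltD], [tilt_slopes]).  Functions with asymptotic slopes lie
    in C_KPZ ([linear_slopes_CKPZ]), so the pullback hypothesis applies to
    (g_-, g_+).

    If h_-, h_+, h_V are the three solutions started at time -T, linearity gives
    e^(h_V) = e^(h_-) + e^(h_+) at time 0, and dividing by the value at 0,
      e^(h_V(x) - h_V(0)) = r e^(h_-(x) - h_-(0)) + (1 - r) e^(h_+(x) - h_+(0)),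
      r = r(T) = e^(h_-(0)) / (e^(h_-(0)) + e^(h_+(0))),
    which is [KPZ_increment_tilt].  Since r(T) stays in [0, 1], Bolzano-Weierstrass
    provides a subsequence of T_k along which it converges to some xi.  The two
    increments on the right converge to f_- and f_+, and
    (r, f, g) |-> log(r e^f + (1 - r) e^g) is jointly continuous on
    [0, 1] * C_KPZ;0 * C_KPZ;0 ([cvg_CKPZ0_mix]), because both defining features
    of the topology, locally uniform convergence of e^f and convergence of the
    Gaussian masses, see only the convex combination r e^f + (1 - r) e^g.

    The probability-one event is the intersection of the one in the pullback
    hypothesis with the one where Z is continuous. *)

(** * Splitting a V-shaped profile into two profiles with opposite slopes *)

Definition softplus (R : realType) (z : R) : R := ln (1 + expR z).

Lemma softplus_arg_gt0 (R : realType) (z : R) : 0 < 1 + expR z.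
Proof. by rewrite addr_gt0 ?expR_gt0. Qed.

Lemma continuous_softplus (R : realType) : continuous (@softplus R).
Proof.
move=> z; apply: (@continuous_comp _ _ _ (fun z => 1 + expR z) (@ln R)).
  by apply: continuousD; [exact: cst_continuous|exact: continuous_expR].
by apply: continuous_ln; exact: softplus_arg_gt0.
Qed.

(** These bounds determine the slopes of softplus at both infinities. *)
Lemma softplus_bounds (R : realType) (z : R) :
  Num.max z 0 <= softplus z <= Num.max z 0 + 1.
Proof.
have p := softplus_arg_gt0 z; rewrite /softplus; apply/andP; split.
  rewrite -ler_expR lnK ?posrE//.
  by case: (leP z 0) => _; rewrite ?expR0 ?lerDl ?lerDr ?expR_ge0// ler01.
rewrite -ler_expR lnK ?posrE// expRD.
have e1 : 1 + 1 <= expR 1 :> R by exact: expR_ge1Dx.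
have m0 : 1 <= expR (Num.max z 0) by rewrite -expR0 ler_expR le_max lexx orbT.
have mz : expR z <= expR (Num.max z 0) by rewrite ler_expR le_max lexx.
nra.
Qed.

Lemma softplus_slope_pinfty (R : realType) (c : R) :
  softplus (c * x) / x @[x --> +oo] --> Num.max c 0.
Proof.
apply: (@squeeze_cvgr _ _ _ _ (cst (Num.max c 0)) (fun x => Num.max c 0 + x^-1)).
- near=> x.
  have x0 : 0 < x by near: x; exact: nbhs_pinfty_gt.
  have -> : Num.max c 0 = Num.max (c * x) 0 / x.
    by rewrite -[0 in RHS](mul0r x) -maxr_pMl ?ltW// mulfK ?gt_eqF.
  have /andP[lo hi] := softplus_bounds (c * x).
  rewrite ler_pM2r ?invr_gt0// lo /=.
  by rewrite -[X in _ + X]mul1r -mulrDl ler_pM2r ?invr_gt0.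
- exact: cvg_cst.
- rewrite -[X in _ --> X]addr0; apply: cvgD; first exact: cvg_cst.
  by apply/(gtr0_cvgV0 (f := id)) => //; exact: nbhs_pinfty_gt.
Unshelve. all: by end_near. Qed.

Lemma softplus_slope_ninfty (R : realType) (c : R) :
  softplus (c * x) / x @[x --> -oo] --> Num.min c 0.
Proof.
have -> : Num.min c 0 = - Num.max (- c) 0 by rewrite oppr_max opprK oppr0.
apply: (iffRL (cvgNy_compNP _ _)).
have h : - (softplus (- c * x) / x) @[x --> +oo] --> - Num.max (- c) 0.
  by apply: cvgN; exact: softplus_slope_pinfty.
apply: (cvg_trans _ h); apply: near_eq_cvg; apply: nearW => x /=.
by rewrite mulrN mulNr invrN mulrN.
Qed.

(** e^(tilt c f) is e^f times the logistic weight 1/(1 + e^(c x)). *)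
Definition tilt (R : realType) (c : R) (f : R -> R) (x : R) : R :=
  f x - softplus (c * x).

(** The two logistic weights add up to 1. *)
Lemma expR_tiltD (R : realType) (c : R) (f : R -> R) (x : R) :
  expR (tilt c f x) + expR (tilt (- c) f x) = expR (f x).
Proof.
rewrite /tilt /softplus !expRD !expRN !lnK ?posrE ?softplus_arg_gt0//.
rewrite mulNr expRN.
have e0 : expR (c * x) != 0 by rewrite gt_eqF ?expR_gt0.
have e1 : 1 + expR (c * x) != 0 by rewrite gt_eqF ?softplus_arg_gt0.
field.
by rewrite e0 addrC e1.
Qed.

Lemma continuous_tilt (R : realType) (c : R) (f : R -> R) :
  continuous f -> continuous (tilt c f).
Proof.
move=> cf x; apply: cvgB; first exact: cf.
apply: (@continuous_comp _ _ _ ( *%R c) (@softplus R)).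
  exact: mulrl_continuous.
exact: continuous_softplus.
Qed.

(** For c = 2 theta both slopes are -theta, for c = -2 theta both are theta. *)
Lemma tilt_slopes (R : realType) (c theta : R) (f : R -> R) :
  cvg_abs_infty (fun x => f x / `|x|) theta ->
  tilt c f x / x @[x --> +oo] --> theta - Num.max c 0 /\
  tilt c f x / x @[x --> -oo] --> - theta - Num.min c 0.
Proof.
move=> [fp fn]; rewrite (_ : (fun x => _) = fun x => f x / x - softplus (c * x) / x).
  split; apply: cvgB; [|exact: softplus_slope_pinfty| |exact: softplus_slope_ninfty].
    apply: (cvg_trans _ fp); apply: near_eq_cvg; near=> x.
    by rewrite gtr0_norm//; near: x; exact: nbhs_pinfty_gt.
  have fn' : - (f x / `|x|) @[x --> -oo] --> - theta by apply: cvgN.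
  apply: (cvg_trans _ fn'); apply: near_eq_cvg; near=> x.
  by rewrite ltr0_norm ?invrN ?mulrN ?opprK//; near: x; exact: nbhs_ninfty_lt.
by apply/funext => x; rewrite /tilt mulrBl.
Unshelve. all: by end_near. Qed.


(** * Functions of linear growth belong to C_KPZ *)

(** Outside a compact interval f is at most K |x| for some K, and the square
    (2 a |x| - K)^2 is nonnegative; on the interval f has a maximum. *)
Lemma linear_growth_quadratic_bound (R : realType) (f : R -> R) (l1 l2 a : R) :
  continuous f -> f x / x @[x --> +oo] --> l1 -> f x / x @[x --> -oo] --> l2 ->
  0 < a -> exists C, forall x, f x <= C + a * x ^+ 2.
Proof.
move=> cf fp fn a0.
have [M1 [_ H1]] : \forall x \near +oo, `|l1 - f x / x| < 1.
  by move/cvgrPdist_lt : fp; exact.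
have [M2 [_ H2]] : \forall x \near -oo, `|l2 - f x / x| < 1.
  by move/cvgrPdist_lt : fn; exact.
pose K := `|l1| + `|l2| + 1; pose N := `|M1| + `|M2| + 1.
have N0 : - N <= N by rewrite /N; have := normr_ge0 M1; have := normr_ge0 M2; lra.
have [c _ cmax] := EVT_max N0 (continuous_subspaceT cf).
have K0 : 0 <= K by rewrite /K; have := normr_ge0 l1; have := normr_ge0 l2; lra.
exists (Num.max (f c) (K ^+ 2 / (4 * a))) => x.
have [xN|xN] := leP `|x| N.
  have : f x <= f c by apply: cmax; rewrite in_itv/= -ler_norml.
  have : f c <= Num.max (f c) (K ^+ 2 / (4 * a)) by rewrite le_max lexx.
  have : 0 <= a * x ^+ 2 by rewrite mulr_ge0 ?sqr_ge0 ?ltW.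
  lra.
have fK : f x <= K * `|x|.
  have Hl1 := ler_norm l1; have Hl2 := ler_norm (- l2); rewrite normrN in Hl2.
  have n1 := normr_ge0 l1; have n2 := normr_ge0 l2.
  have [x0|x0|x0] := ltgtP x 0.
  - have /H2 : x < M2.
      move: xN; rewrite ltr0_norm// /N.
      have := normr_ge0 M1; have := ler_norm (- M2); rewrite normrN; lra.
    rewrite ltr_distl => /andP[_ h].
    move: h; rewrite -ltrBlDr ltr_ndivlMr// => h.
    rewrite ltr0_norm// /K; nra.
  - have /H1 : M1 < x.
      move: xN; rewrite gtr0_norm// /N.
      have := normr_ge0 M2; have := ler_norm M1; lra.
    rewrite ltr_distlC => /andP[_ h].
    move: h; rewrite ltr_pdivrMr// => h.
    rewrite gtr0_norm// /K; nra.
  - by move: xN; rewrite x0 normr0 /N; have := normr_ge0 M1; have := normr_ge0 M2; lra.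
have : K ^+ 2 / (4 * a) <= Num.max (f c) (K ^+ 2 / (4 * a)).
  by rewrite le_max lexx orbT.
suff : K * `|x| <= K ^+ 2 / (4 * a) + a * x ^+ 2 by lra.
have -> : K ^+ 2 / (4 * a) + a * x ^+ 2 =
    K * `|x| + (2 * a * `|x| - K) ^+ 2 / (4 * a).
  by rewrite -(real_normK (num_real x)); field; rewrite gt_eqF.
by rewrite lerDl divr_ge0 ?sqr_ge0// mulr_ge0 ?ltW.
Qed.

(** The integrand is proportional to the normal density of variance 1/(2a). *)
Lemma gauss_integral_lty (R : realType) (a : R) : 0 < a ->
  (\int[lebesgue_measure]_x (expR (- (a * x ^+ 2)))%:E < +oo)%E.
Proof.
move=> a0; pose s := Num.sqrt (2 * a)^-1.
have s2 : s ^+ 2 = (2 * a)^-1 by rewrite sqr_sqrtr// invr_ge0 mulr_ge0 ?ltW.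
have s0 : s != 0 by rewrite gt_eqF// sqrtr_gt0 invr_gt0 mulr_gt0.
have E x : (expR (- (a * x ^+ 2)))%:E =
    ((normal_peak s)^-1%:E * (normal_pdf 0 s x)%:E)%E.
  rewrite -EFinM normal_pdfE// mulKf ?gt_eqF ?normal_peak_gt0//.
  rewrite /normal_fun subr0 s2; congr (expR _)%:E; field.
  by rewrite gt_eqF.
under eq_integral do rewrite E.
rewrite ge0_integralZl//=.
- by rewrite integral_normal_pdf mule1 ltry.
- apply/measurable_EFinP; exact: measurable_normal_pdf.
- by move=> x _; rewrite lee_fin normal_pdf_ge0.
- by rewrite lee_fin invr_ge0 normal_peak_ge0.
Qed.

Lemma measurable_gauss_integrand (R : realType) (f : R -> R) (a : R) :
  continuous f -> measurable_fun setT (fun x => expR (f x - a * x ^+ 2)).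
Proof.
move=> cf; apply: continuous_measurable_fun => x.
apply: (@continuous_comp _ _ _ (fun x => f x - a * x ^+ 2) (@expR R)).
  apply: cvgB; first exact: cf.
  by apply: cvgM; [exact: cvg_cst|exact: exprn_continuous].
exact: continuous_expR.
Qed.

(** Half of the Gaussian weight absorbs f up to a constant, the other half is
    integrable. *)
Lemma linear_slopes_CKPZ (R : realType) (f : R -> R) (l1 l2 : R) :
  continuous f -> f x / x @[x --> +oo] --> l1 -> f x / x @[x --> -oo] --> l2 ->
  CKPZ_set R f.
Proof.
move=> cf fp fn; split=> // a a0.
have a20 : 0 < a / 2 by rewrite divr_gt0.
have [C fC] := linear_growth_quadratic_bound cf fp fn a20.
have le x : ((expR (f x - a * x ^+ 2))%:E <=
    (expR C)%:E * (expR (- (a / 2 * x ^+ 2)))%:E)%E.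
  rewrite -EFinM -expRD lee_fin ler_expR.
  by have := fC x; lra.
have mg : measurable_fun setT (fun x : R => expR (- (a / 2 * x ^+ 2))).
  under eq_fun do rewrite -[X in expR X]add0r.
  by apply: (@measurable_gauss_integrand R (fun=> 0)); exact: cst_continuous.
rewrite /gauss_mass.
apply: (@le_lt_trans _ _ (\int[lebesgue_measure]_x
    ((expR C)%:E * (expR (- (a / 2 * x ^+ 2)))%:E))%E).
  apply: ge0_le_integral => //.
  - by apply/measurable_EFinP; exact: measurable_gauss_integrand.
  - by move/measurable_EFinP : mg => /(measurable_funeM (expR C)%:E).
rewrite ge0_integralZl//; last exact/measurable_EFinP.
by rewrite lte_mul_pinfty ?lee_fin ?expR_ge0// gauss_integral_lty.
Qed.


(** * Logarithms of convex combinations in C_KPZ;0 *)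

Definition convex_mix (R : realType) (xi : R) (f g : R -> R) (x : R) : R :=
  xi * expR (f x) + (1 - xi) * expR (g x).

Lemma convex_mix_gt0 (R : realType) (xi : R) (f g : R -> R) (x : R) :
  0 <= xi <= 1 -> 0 < convex_mix xi f g x.
Proof.
move=> /andP[x0 x1]; rewrite /convex_mix.
have := expR_gt0 (f x); have := expR_gt0 (g x); nra.
Qed.

Definition log_mix (R : realType) (xi : R) (f g : R -> R) (x : R) : R :=
  ln (convex_mix xi f g x).

Lemma expR_log_mix (R : realType) (xi : R) (f g : R -> R) (x : R) :
  0 <= xi <= 1 -> expR (log_mix xi f g x) = convex_mix xi f g x.
Proof. by move=> xi01; rewrite lnK// posrE convex_mix_gt0. Qed.

Lemma continuous_log_mix (R : realType) (xi : R) (f g : R -> R) :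
  0 <= xi <= 1 -> continuous f -> continuous g -> continuous (log_mix xi f g).
Proof.
move=> xi01 cf cg x; apply: (@continuous_comp _ _ _ (convex_mix xi f g) (@ln R)).
  apply: cvgD; apply: cvgM; try exact: cvg_cst.
    by apply: (@continuous_comp _ _ _ f (@expR R)); [exact: cf|exact: continuous_expR].
  by apply: (@continuous_comp _ _ _ g (@expR R)); [exact: cg|exact: continuous_expR].
by apply: continuous_ln; exact: convex_mix_gt0.
Qed.

(** The Gaussian mass is affine in e^f, hence in the mixture. *)
Lemma gauss_mass_log_mix (R : realType) (xi a : R) (f g : R -> R) :
  0 <= xi <= 1 -> continuous f -> continuous g ->
  gauss_mass (log_mix xi f g) a =
    (xi%:E * gauss_mass f a + (1 - xi)%:E * gauss_mass g a)%E.
Proof.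
move=> xi01 cf cg; have /andP[xi0 xi1] := xi01.
have m (h : R -> R) : continuous h ->
    measurable_fun setT (fun x => (expR (h x - a * x ^+ 2))%:E).
  by move=> ch; apply/measurable_EFinP; exact: measurable_gauss_integrand.
have nn (h : R -> R) x : (0 <= (expR (h x - a * x ^+ 2))%:E)%E.
  by rewrite lee_fin expR_ge0.
rewrite /gauss_mass -!ge0_integralZl//; do ?[exact: m|by rewrite lee_fin; lra].
rewrite -ge0_integralD//.
- apply: eq_integral => x _.
  rewrite -!EFinM -EFinD; congr EFin.
  by rewrite expRD expR_log_mix// /convex_mix mulrDl -!mulrA -!expRD.
- by move=> x _; rewrite mule_ge0.
- exact: (measurable_funeM _ (m _ _)).
- by move=> x _; rewrite mule_ge0// lee_fin; lra.
- exact: (measurable_funeM _ (m _ _)).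
Qed.

Definition mkCKPZ (R : realType) (f : R -> R) (hf : CKPZ_set R f) : CKPZ R :=
  exist _ f (mem_set hf).

Lemma mkCKPZE (R : realType) (f : R -> R) (hf : CKPZ_set R f) :
  (mkCKPZ hf : R -> R) = f.
Proof. by []. Qed.

Lemma CKPZP (R : realType) (f : CKPZ R) : CKPZ_set R f.
Proof. exact: (@set_valP _ (CKPZ_set R) f). Qed.

Lemma CKPZ0P (R : realType) (f : CKPZ0 R) : f 0 = 0.
Proof. exact: (@set_valP _ (CKPZ0_set R) f). Qed.

Lemma log_mix_CKPZ (R : realType) (xi : R) (f g : CKPZ0 R) :
  0 <= xi <= 1 -> CKPZ_set R (log_mix xi f g).
Proof.
move=> xi01; have [cf ff] := CKPZP f; have [cg fg] := CKPZP g.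
split=> [|a a0]; first exact: continuous_log_mix.
rewrite gauss_mass_log_mix// lte_add_pinfty//.
  by case/andP: xi01 => xi0 _; rewrite lte_mul_pinfty// ff.
by rewrite lte_mul_pinfty// ?fg// lee_fin; case/andP: xi01; lra.
Qed.

Lemma log_mix0 (R : realType) (xi : R) (f g : CKPZ0 R) (xi01 : 0 <= xi <= 1) :
  CKPZ0_set R (mkCKPZ (log_mix_CKPZ f g xi01)).
Proof.
rewrite /CKPZ0_set /= mkCKPZE /log_mix /convex_mix !CKPZ0P expR0 !mulr1.
by rewrite addrC subrK ln1.
Qed.

Definition CKPZ0_mix (R : realType) (xi : R) (xi01 : 0 <= xi <= 1)
    (f g : CKPZ0 R) : CKPZ0 R :=
  exist _ (mkCKPZ (log_mix_CKPZ f g xi01)) (mem_set (log_mix0 f g xi01)).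

Lemma CKPZ0_mixE (R : realType) (xi : R) (xi01 : 0 <= xi <= 1)
    (f g : CKPZ0 R) : (CKPZ0_mix xi01 f g : R -> R) = log_mix xi f g.
Proof. by []. Qed.


(** * Continuity of the log-mixture *)

Lemma uniform_cvg_dist (R : realType) (I : Type) (F : set_system I)
    (FF : Filter F) (A : set R) (u : I -> R -> R) (f : R -> R) :
  {uniform A, u @ F --> f} <->
  forall e : R, 0 < e -> \forall i \near F, forall x, A x -> `|f x - u i x| < e.
Proof.
split=> [uf e e0|uf].
  have : nbhs (f : {uniform` A -> R}) [set h | forall y, A y -> `|f y - h y| < e].
    apply/uniform_nbhs; exists [set xy | `|xy.1 - xy.2| < e]; split => //.
    by rewrite -entourage_ballE; exists e.
  by move/uf.
move=> V /uniform_nbhs[E [entE EV]].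
have [e e0 eE] : exists2 e : R, 0 < e & [set xy : R * R | `|xy.1 - xy.2| < e] `<=` E.
  by move: entE; rewrite -entourage_ballE.
apply: (filterS _ (uf e e0)) => i ui; apply: EV => y Ay.
by apply: eE; exact: ui.
Qed.

(** The error is expanded around the limit weight t, so that only the limit values
    a and b need a bound. *)
Lemma convex_mix_dist (R : realType) (t s a b a' b' M : R) :
  0 <= s <= 1 -> `|a| + `|b| <= M ->
  `|(t * a + (1 - t) * b) - (s * a' + (1 - s) * b')| <=
    `|t - s| * M + `|a - a'| + `|b - b'|.
Proof.
move=> /andP[s0 s1] abM.
have -> : (t * a + (1 - t) * b) - (s * a' + (1 - s) * b') =
  (t - s) * (a - b) + s * (a - a') + (1 - s) * (b - b') by ring.
apply: (le_trans (ler_normD _ _)); apply: lerD; last first.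
  rewrite normrM ler_piMl// ger0_norm; lra.
apply: (le_trans (ler_normD _ _)); apply: lerD; last first.
  by rewrite normrM ler_piMl// ger0_norm.
by rewrite normrM ler_wpM2l// (le_trans (ler_normB _ _)).
Qed.

(** On a compact set e^f and e^g are bounded, so [convex_mix_dist] controls the
    mixtures uniformly; the Gaussian masses are sums of products of converging
    real numbers. *)
Lemma cvg_CKPZ0_mix (R : realType) (I : Type) (F : set_system I)
    (FF : Filter F) (xi : I -> R) (xi01 : forall i, 0 <= xi i <= 1)
    (l : R) (l01 : 0 <= l <= 1) (u v : I -> CKPZ0 R) (f g : CKPZ0 R) :
  xi @ F --> l -> u @ F --> f -> v @ F --> g ->
  (fun i => CKPZ0_mix (xi01 i) (u i) (v i)) @ F --> CKPZ0_mix l01 f g.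
Proof.
move=> xil /cvg_CKPZ0/cvg_CKPZ[uf uf'] /cvg_CKPZ0/cvg_CKPZ[vg vg'].
apply/cvg_CKPZ0/cvg_CKPZ; split; last first.
  move=> a a0; pose m (h : CKPZ0 R) := fine (gauss_mass h a).
  have E (s : R) (s01 : 0 <= s <= 1) (p q : CKPZ0 R) :
      m (CKPZ0_mix s01 p q) = s * m p + (1 - s) * m q.
    have fin (h : CKPZ0 R) : gauss_mass h a \is a fin_num.
      have [_ hfin] := CKPZP h.
      by rewrite ge0_fin_numE ?hfin// integral_ge0// => x _; rewrite lee_fin expR_ge0.
    rewrite /m CKPZ0_mixE gauss_mass_log_mix//; [|exact: (CKPZP p).1|exact: (CKPZP q).1].
    by rewrite -(fineK (fin p)) -(fineK (fin q)).
  have um : m (u i) @[i --> F] --> m f := uf' a a0.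
  have vm : m (v i) @[i --> F] --> m g := vg' a a0.
  suff : m (CKPZ0_mix (xi01 i) (u i) (v i)) @[i --> F] --> m (CKPZ0_mix l01 f g).
    by [].
  (* From here on the mass matters only through E, um and vm. *)
  clearbody m; rewrite E; under eq_fun do rewrite E.
  apply: cvgD; apply: cvgM => //.
  by apply: cvgB => //; exact: cvg_cst.
apply/fam_cvgP => A cA; apply/uniform_cvg_dist => e e0.
move/fam_cvgP : uf => /(_ A cA)/uniform_cvg_dist uf.
move/fam_cvgP : vg => /(_ A cA)/uniform_cvg_dist vg.
have [M M0 fgM] : exists2 M : R, 0 < M & forall x, A x ->
    `|expR (f x)| + `|expR (g x)| <= M.
  have ce (h : CKPZ0 R) : continuous (fun x => expR (h x)).
    move=> x; apply: (@continuous_comp _ _ _ h (@expR R)).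
      exact: (CKPZP h).1.
    exact: continuous_expR.
  have cs : compact ((fun x => `|expR (f x)| + `|expR (g x)|) @` A).
    apply: continuous_compact cA; apply: continuous_subspaceT => x.
    by apply: cvgD; apply: cvg_norm; exact: ce.
  have [M [_ MA]] := compact_bounded cs.
  exists (`|M| + 1) => [|x Ax]; first by have := normr_ge0 M; lra.
  apply: (le_trans (ler_norm _)); apply: (MA (`|M| + 1)).
    by rewrite (le_lt_trans (ler_norm M))// ltrDl.
  by exists x.
have e3 : 0 < e / 3 by rewrite divr_gt0.
near=> i => x Ax.
rewrite !CKPZ0_mixE !expR_log_mix// /convex_mix.
apply: le_lt_trans (convex_mix_dist _ _ _ (xi01 i) (fgM x Ax)) _.
have h : `|l - xi i| * M < e / 3.
  rewrite -ltr_pdivlMr//; near: i.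
  by move/cvgrPdist_lt : xil; apply; rewrite divr_gt0.
have hu : `|expR (f x) - expR (u i x)| < e / 3.
  by move: x Ax; near: i; exact: uf.
suff : `|expR (g x) - expR (v i x)| < e / 3 by lra.
by move: {hu} x Ax; near: i; exact: vg.
Unshelve. all: by end_near. Qed.


(** * Linearity of the flow and the identity for the increments *)

(** The integral is the difference of the integrals of the positive and negative
    parts, and a difference of extended reals is finite only if both terms are. *)
Lemma fin_num_integrable d (T : measurableType d) (R : realType)
    (mu : {measure set T -> \bar R}) (f : T -> \bar R) :
  measurable_fun setT f -> (\int[mu]_x f x)%E \is a fin_num ->
  mu.-integrable setT f.
Proof.
move=> mf; rewrite integralE fin_numB => /andP[fp fn].
apply/integrableP; split => //.
rewrite -[X in (\int[_]_(x in _) X x)%E]/((abse \o f)%E) fune_abse.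
rewrite ge0_integralD//; last 2 first.
- exact: measurable_funepos.
- exact: measurable_funeneg.
by rewrite lte_add_pinfty// ltey_eq ?fp ?fn.
Qed.

(** The solution at time 0 of the stochastic heat equation started from e^f at
    time -T. *)
Definition SHE_flow (R : realType) (Z : R * R -> R * R -> R) (T : R)
    (f : R -> R) (x : R) : \bar R :=
  (\int[lebesgue_measure]_y (Z (0, x) (- T, y) * expR (f y))%:E)%E.

(** The logarithm is -oo at nonpositive numbers, so a finite solution of the KPZ
    equation certifies that the integral is positive and finite. *)
Lemma KPZ_solution_fin (R : realType) (Z : R * R -> R * R -> R) (T x : R)
    (f : R -> R) : KPZ_solution Z (- T) f 0 x \is a fin_num ->
  SHE_flow Z T f x = (expR (fine (KPZ_solution Z (- T) f 0 x)))%:E.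
Proof.
rewrite /KPZ_solution -/(SHE_flow Z T f x); case: (SHE_flow Z T f x) => //= r.
by case: ifPn => //; rewrite -ltNge => r0 _; rewrite /= lnK.
Qed.

Lemma KPZ_increment_fin (R : realType) (Z : R * R -> R * R -> R) (T x r : R)
    (f : R -> R) : KPZ_increment Z f T x = r%:E ->
  [/\ KPZ_solution Z (- T) f 0 x \is a fin_num,
      KPZ_solution Z (- T) f 0 0 \is a fin_num &
      r = fine (KPZ_solution Z (- T) f 0 x) - fine (KPZ_solution Z (- T) f 0 0)].
Proof.
move=> E; have : KPZ_increment Z f T x \is a fin_num by rewrite E.
rewrite /KPZ_increment fin_numB => /andP[f1 f2]; split=> //.
by apply: EFin_inj; rewrite -E EFinB !fineK.
Qed.

(** Finiteness of the two one-sided integrals makes both integrands integrable,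
    whence additivity. *)
Lemma SHE_flowD (R : realType) (Z : R * R -> R * R -> R) (T x c : R)
    (f : R -> R) :
  measurable_fun setT (fun y => Z (0, x) (- T, y)) -> continuous f ->
  SHE_flow Z T (tilt c f) x \is a fin_num ->
  SHE_flow Z T (tilt (- c) f) x \is a fin_num ->
  SHE_flow Z T f x =
    (SHE_flow Z T (tilt c f) x + SHE_flow Z T (tilt (- c) f) x)%E.
Proof.
move=> mZ cf fin1 fin2.
have m a : measurable_fun setT
    (fun y => (Z (0%R, x) (- T, y) * expR (tilt a f y))%:E).
  apply/measurable_EFinP/measurable_funM => //.
  apply: continuous_measurable_fun => y.
  apply: (@continuous_comp _ _ _ (tilt a f) (@expR R)).
    exact: continuous_tilt.
  exact: continuous_expR.
rewrite /SHE_flow -integralD//.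
- by apply: eq_integral => y _; rewrite -EFinD -mulrDr expR_tiltD.
- exact: (@fin_num_integrable _ _ _ lebesgue_measure _ (m c) fin1).
- exact: (@fin_num_integrable _ _ _ lebesgue_measure _ (m (- c)) fin2).
Qed.

(** The weight of the first one-sided solution at the origin, when a and b are the
    values there of the two solutions of the KPZ equation. *)
Definition mass_ratio (R : realType) (a b : R) : R := expR a / (expR a + expR b).

Lemma mass_ratio01 (R : realType) (a b : R) : 0 <= mass_ratio a b <= 1.
Proof.
have a0 := expR_gt0 a; have b0 := expR_gt0 b.
apply/andP; split; first by rewrite divr_ge0// ltW// addr_gt0.
by rewrite ler_pdivrMr ?addr_gt0// mul1r lerDl ltW.
Qed.

Lemma ln_addB (R : realType) (p q p0 q0 : R) :
  ln (expR p + expR q) - ln (expR p0 + expR q0) =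
  ln (mass_ratio p0 q0 * expR (p - p0) + (1 - mass_ratio p0 q0) * expR (q - q0)).
Proof.
have P := expR_gt0 p; have Q := expR_gt0 q.
have P0 := expR_gt0 p0; have Q0 := expR_gt0 q0.
rewrite -ln_div ?posrE ?addr_gt0// /mass_ratio !expRD !expRN; congr ln.
by field; rewrite ?gt_eqF ?addr_gt0.
Qed.

(** The weight of the mixture depends on T but not on x.  Finiteness of the two
    increments on the whole line gives the positivity and finiteness of the
    one-sided integrals, both at x and at 0. *)
Lemma KPZ_increment_tilt (R : realType) (Z : R * R -> R * R -> R) (T x c : R)
    (f : R -> R) (v1 v2 : R -> R) :
  (forall x, measurable_fun setT (fun y => Z (0, x) (- T, y))) -> continuous f ->
  (forall x, KPZ_increment Z (tilt c f) T x = (v1 x)%:E) ->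
  (forall x, KPZ_increment Z (tilt (- c) f) T x = (v2 x)%:E) ->
  KPZ_increment Z f T x =
   (log_mix (mass_ratio (fine (KPZ_solution Z (- T) (tilt c f) 0 0))
                        (fine (KPZ_solution Z (- T) (tilt (- c) f) 0 0)))
            v1 v2 x)%:E.
Proof.
move=> mZ cf h1 h2; have h1x := h1 x; have h2x := h2 x.
have [a1 b1 e1] := KPZ_increment_fin h1x.
have [a2 b2 e2] := KPZ_increment_fin h2x.
have flow y : KPZ_solution Z (- T) (tilt c f) 0 y \is a fin_num ->
    KPZ_solution Z (- T) (tilt (- c) f) 0 y \is a fin_num ->
    KPZ_solution Z (- T) f 0 y =
    (ln (expR (fine (KPZ_solution Z (- T) (tilt c f) 0 y)) +
         expR (fine (KPZ_solution Z (- T) (tilt (- c) f) 0 y))))%:E.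
  move=> /KPZ_solution_fin E1 /KPZ_solution_fin E2.
  rewrite {1}/KPZ_solution -/(SHE_flow Z T f y) (@SHE_flowD _ _ _ _ c)// ?E1 ?E2//.
  by rewrite -EFinD lne_EFin// addr_gt0 ?expR_gt0.
rewrite /KPZ_increment !flow// -EFinB; congr EFin.
by rewrite ln_addB /log_mix /convex_mix e1 e2.
Qed.

Theorem theorem1p7 (R : realType) (d : measure_display)
    (Omega : measurableType d) (P : probability Omega R)
    (W : set (R * R) -> Omega -> R) (hW : white_noise P W)
    (Z : Omega -> R * R -> R * R -> R) (hZ : SHE_fundamental_solution P W Z)
    (theta : R) (htheta : 0 < theta)
    (fbar : Omega -> CKPZ0 R * CKPZ0 R)
    (hfbar : KPZ_pullback_limit P Z theta fbar) :
  exists E : set Omega, [/\ measurable E, P E = 1%E &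
    forall w, E w ->
    forall fV : R -> R, continuous fV ->
      cvg_abs_infty (fun x => fV x / `|x|) theta ->
    forall Tk : nat -> R, nondecreasing_seq Tk -> Tk @ \oo --> +oo ->
    exists (k : nat -> nat) (xi : R) (g : CKPZ0 R),
      [/\ {homo k : m n / (m < n)%N >-> (m < n)%N},
          0 <= xi <= 1,
          (forall x, g x = ln (xi * expR ((fbar w).1 x)
                               + (1 - xi) * expR ((fbar w).2 x))) &
          cvg_in_CKPZ0 \oo (fun l => KPZ_increment (Z w) fV (Tk (k l))) g]].
Proof.
have [_ aeY] := hfbar; have [_ aeZ] := hZ.
have [N [mN N0 NE]] := filterI aeY aeZ.
exists (~` N); split; first exact: measurableC.
  by rewrite probability_setC// N0 sube0.
move=> w Nw fV cV slopeV Tk _ Tkoo.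
have [Yw Zw] := contra_notP (@NE w) Nw; move=> {aeY aeZ N mN N0 NE Nw}.
have th2 : 0 <= 2 * theta by rewrite mulr_ge0// ltW.
have th2' : - (2 * theta) <= 0 by rewrite oppr_le0.
have [slope1p slope1n] := tilt_slopes (2 * theta) slopeV.
have [slope2p slope2n] := tilt_slopes (- (2 * theta)) slopeV.
have K1 := linear_slopes_CKPZ (continuous_tilt cV) slope1p slope1n.
have K2 := linear_slopes_CKPZ (continuous_tilt cV) slope2p slope2n.
have Y12 : Ytheta theta (mkCKPZ K1, mkCKPZ K2).
  have e1 : theta - Num.max (2 * theta) 0 = - theta by rewrite max_l//; ring.
  have e2 : - theta - Num.min (2 * theta) 0 = - theta by rewrite min_r//; ring.
  have e3 : theta - Num.max (- (2 * theta)) 0 = theta by rewrite max_r//; ring.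
  have e4 : - theta - Num.min (- (2 * theta)) 0 = theta by rewrite min_l//; ring.
  by rewrite e1 in slope1p; rewrite e2 in slope1n;
     rewrite e3 in slope2p; rewrite e4 in slope2n.
have [[v1 [ev1 cv1]] [v2 [ev2 cv2]]] := Yw _ Y12.
rewrite /= !mkCKPZE in ev1 ev2.
pose r T := mass_ratio (fine (KPZ_solution (Z w) (- T) (tilt (2 * theta) fV) 0 0))
              (fine (KPZ_solution (Z w) (- T) (tilt (- (2 * theta)) fV) 0 0)).
have r01 T : 0 <= r T <= 1 by exact: mass_ratio01.
have [k kinc kcvg] : exists2 k : nat -> nat,
    increasing_seq k & cvgn ((r \o Tk) \o k).
  apply: bolzano_weierstrass; exists 1; split => // M M1 n _ /=.
  by rewrite ger0_norm ?(andP (r01 (Tk n))).1// (le_trans (andP (r01 (Tk n))).2)// ltW.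
pose l := limn ((r \o Tk) \o k).
have l01 : 0 <= l <= 1.
  by rewrite limr_ge ?limr_le//; apply: nearW => n /=; case/andP: (r01 (Tk (k n))).
have Tkk : (Tk \o k) @ \oo --> +oo.
  apply: (cvg_comp k Tk _ Tkoo); apply/cvgnyPge => A; near=> n.
  have kn m : (m <= k m)%N.
    by elim: m => // m /leq_ltn_trans -> //; rewrite (leqW_mono kinc).
  by apply: leq_trans (kn n); near: n; exact: nbhs_infty_ge.
exists k, l, (CKPZ0_mix l01 (fbar w).1 (fbar w).2); split => //.
  by move=> m n mn; rewrite (leqW_mono kinc).
exists (fun n => CKPZ0_mix (r01 (Tk (k n))) (v1 (Tk (k n))) (v2 (Tk (k n)))); split.
  (* For T > 0 the point (- T, y) lies strictly before time 0, where Z is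
     continuous. *)
  have mZ : \forall T \near +oo, forall x,
      measurable_fun setT (fun y => Z w (0, x) (- T, y)).
    near=> T => x; apply: continuous_measurable_fun => y.
    have T0 : - T < 0 by rewrite oppr_lt0; near: T; exact: nbhs_pinfty_gt.
    have /= Zc := Zw ((0, x), (- T, y)) T0.
    apply: (@continuous_comp _ _ _ (fun y => ((0, x), (- T, y)))
      (fun p : (R * R) * (R * R) => Z w p.1 p.2)) => //.
    exact: (cvg_pair (cvg_cst _) (cvg_pair (cvg_cst _) cvg_id)).
  have : \forall T \near +oo, forall x, KPZ_increment (Z w) fV T x =
      (CKPZ0_mix (r01 T) (v1 T) (v2 T) x)%:E.
    near=> T => x.
    rewrite CKPZ0_mixE; apply: KPZ_increment_tilt => //.
    - by near: T.
    - by near: T.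
    - by near: T.
  by move/Tkk.
apply: cvg_CKPZ0_mix => //.
  exact: (cvg_comp _ _ Tkk cv1).
exact: (cvg_comp _ _ Tkk cv2).
Unshelve. all: by end_near. Qed.
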